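(* Let $G$ be a nonempty graph (that is, a finite simple graph with at least one edge). The following are equivalent. (i) $c_2(G) \neq \mathrm{mr}(G,\mathbb{F}_2)$; (ii) $c_2(G) = \mathrm{mr}(G,\mathbb{F}_2) + 1$; (iii) there is a unique matrix $A$ of minimum rank over $\mathbb{F}_2$ which fits $G$, and every diagonal entry of $A$ is $0$; (iv) there is a minimum subgraph complementation system for $G$ in which every vertex appears an even number of times; (v) for every component $G'$ of $G$, $c_2(G') = \mathrm{mr}(G', \mathbb{F}_2) + 1$.
   Context: All graphs are finite and simple. A component of a graph is a connected component. A subgraph complementation system for a graph $G=(V,E)$ is a finite collection (family) $\mathscr{C}$ of subsets of $V$ such that, for any two distinct vertices $u,v\in V$, $uv\in E$ if and only if $u$ and $v$ appear together in an odd number of sets in $\mathscr{C}$. The subgraph complementation number $c_2(G)$ is the minimum cardinality of a subgraph complementation system for $G$; a subgraph complementation system is minimum if its cardinality is $c_2(G)$. The number of times a vertex $v$ appears in $\mathscr{C}$ is the number of sets of $\mathscr{C}$ containing $v$. A symmetric matrix over a field $\mathbb{F}$ with rows and columns indexed by $V$ fits $G$ if, for distinct $u,v$, its $(u,v)$ entry is nonzero if and only if $uv\in E$ (the diagonal is arbitrary). $\mathrm{mr}(G,\mathbb{F})$ is the minimum rank over $\mathbb{F}$ of a symmetric matrix over $\mathbb{F}$ which fits $G$; a matrix of minimum rank over $\mathbb{F}_2$ which fits $G$ is one of rank $\mathrm{mr}(G,\mathbb{F}_2)$. Here $\mathbb{F}_2$ is the field of order $2$.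
   Formalization: In (v), only components with at least one edge are considered; as stated, (v) fails for any graph with an isolated vertex since c_2(K_1) = mr(K_1, F_2) = 0, e.g. K_{3,3} plus an isolated vertex satisfies (i)–(iv) but not (v). *)

(* Defs.v *)
From mathcomp Require Import all_boot all_order all_algebra.

Set Implicit Arguments.
Unset Strict Implicit.
Unset Printing Implicit Defensive.

Import GRing.Theory.
Local Open Scope ring_scope.

Record sgraph := SGraph {
  vertex :> finType;
  edge : rel vertex;
  edge_sym : symmetric edge;
  edge_irr : irreflexive edge }.

Definition has_edge (G : sgraph) : Prop := exists u v : G, edge u v.

Section Induced.
Variables (G : sgraph) (S : {set G}).

Definition induced_edge : rel {x : G | x \in S} :=
  fun x y => edge (val x) (val y).

Lemma induced_sym : symmetric induced_edge.
Proof. by move=> x y; apply: edge_sym. Qed.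

Lemma induced_irr : irreflexive induced_edge.
Proof. by move=> x; apply: edge_irr. Qed.

Definition induced : sgraph := SGraph induced_sym induced_irr.
End Induced.

(* Vertex sets of the connected components; as graphs, the components are the
   subgraphs [induced S] with [S \in components G]. *)
Definition components (G : sgraph) : {set {set G}} :=
  equivalence_partition (connect (@edge G)) [set: G].

Definition is_scs (G : sgraph) (C : {set {set G}}) : bool :=
  [forall u, forall v, (u != v) ==>
     (edge u v == odd #|[set S in C | (u \in S) && (v \in S)]|)].

(* The set of all edges, as two-element vertex sets, is a system. *)
Lemma scs_exists (G : sgraph) :
  exists n, [exists C : {set {set G}}, is_scs C && (#|C| == n)].
Proof.
pose C := [set [set p.1; p.2] | p : G * G in [pred p | edge p.1 p.2]].
exists #|C|; apply/existsP; exists C; rewrite eqxx andbT.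
apply/forallP=> u; apply/forallP=> v; apply/implyP=> uv; apply/eqP.
suff ->: [set S in C | (u \in S) && (v \in S)] =
         if edge u v then [set [set u; v]] else set0.
  by case: (edge u v); rewrite ?cards1 ?cards0.
apply/setP=> S; rewrite inE; apply/andP/idP => [[]|].
  case/imsetP=> -[a b] /=; rewrite inE /= => eab -> /andP[].
  rewrite !in_set2 => /orP[] /eqP ua /orP[] /eqP vb; subst.
  - by rewrite eqxx in uv.
  - by rewrite eab in_set1.
  - by rewrite edge_sym eab in_set1 setUC.
  - by rewrite eqxx in uv.
case: ifP => [euv|]; last by rewrite in_set0.
rewrite in_set1 => /eqP ->; split; last by rewrite !in_set2 !eqxx orbT.
by apply/imsetP; exists (u, v).
Qed.

Definition c2 (G : sgraph) : nat := ex_minn (scs_exists G).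

Definition is_min_scs (G : sgraph) (C : {set {set G}}) : Prop :=
  is_scs C /\ #|C| = c2 G.

(* Row and column i are those of the vertex [enum_val i]. *)
Definition fits (F : finFieldType) (G : sgraph) (A : 'M[F]_#|G|) : bool :=
  (A^T == A) &&
  [forall i, forall j, (i != j) ==>
     ((A i j != 0) == edge (enum_val i) (enum_val j))].

Lemma fit_exists (F : finFieldType) (G : sgraph) :
  exists n, [exists A : 'M[F]_#|G|, fits A && (\rank A == n)%N].
Proof.
pose A : 'M[F]_#|G| := \matrix_(i, j) (edge (enum_val i) (enum_val j))%:R.
exists (\rank A); apply/existsP; exists A; rewrite eqxx andbT.
apply/andP; split; first by apply/eqP/matrixP=> i j; rewrite !mxE edge_sym.
apply/forallP=> i; apply/forallP=> j; apply/implyP=> _; rewrite mxE.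
by case: (edge _ _); rewrite ?oner_eq0 ?eqxx.
Qed.

Definition mr (G : sgraph) (F : finFieldType) : nat := ex_minn (fit_exists F G).

Definition is_min_rank_fit (F : finFieldType) (G : sgraph) (A : 'M[F]_#|G|) :
  Prop := fits A /\ \rank A = mr G F.

(* Main.v *)
(** A family of k vertex sets with incidence matrix M is a subgraph
    complementation system exactly when M M^T fits G, so c_2(G) is the least k
    for which some n x k matrix M has M M^T fitting G. A nonzero symmetric matrix
    over F_2 of rank r factors as M M^T with r columns when its diagonal is
    nonzero, and with r + 1 columns otherwise; conversely, if M M^T has zero
    diagonal then the rows of M are orthogonal to the all-ones vector, so M does
    not have full column rank. Hence c_2(G) = mr(G) exactly when some minimum
    rank fit has a nonzero diagonal entry. Minimum rank fits are block diagonal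
    over the components and blocks can be exchanged freely, which makes this
    criterion local to the components. *)
Require Import Defs.
From mathcomp Require Import all_boot all_order all_algebra.

Set Implicit Arguments.
Unset Strict Implicit.
Unset Printing Implicit Defensive.

Import GRing.Theory.
Local Open Scope ring_scope.

(** * Arithmetic and matrices over F_2 *)

Lemma F2_eq_natr (x : 'F_2) : x = (x != 0)%:R.
Proof. by case: x => -[|[|m]] //= lt_m; apply/val_inj. Qed.

Lemma F2_neq0 (x : 'F_2) : x != 0 -> x = 1.
Proof. by rewrite {2}(F2_eq_natr x) => ->. Qed.

Lemma F2_addrr (x : 'F_2) : x + x = 0.
Proof. by rewrite -mulr2n -mulr_natl pchar_Zp ?mul0r. Qed.

Lemma F2_eq_add0 (x y : 'F_2) : x + y = 0 -> x = y.
Proof. by move=> xy0; rewrite -[x]addr0 -(F2_addrr y) addrA xy0 add0r. Qed.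

Lemma F2_mulrr (x : 'F_2) : x * x = x.
Proof. by rewrite (F2_eq_natr x); case: (x != 0); rewrite ?mulr1 ?mulr0. Qed.

Lemma F2_natr_odd (n : nat) : n%:R = (odd n)%:R :> 'F_2.
Proof.
elim: n => // n IHn; rewrite -natr1 IHn /=.
by case: (odd n); rewrite /= ?add0r ?F2_addrr.
Qed.

Lemma F2_odd_neq0 (n : nat) : odd n = (n%:R != 0 :> 'F_2).
Proof. by rewrite F2_natr_odd; case: (odd n); rewrite ?eqxx ?oner_eq0. Qed.

Lemma F2mx_addrr m n (A : 'M['F_2]_(m, n)) : A + A = 0.
Proof. by apply/matrixP=> i j; rewrite !mxE F2_addrr. Qed.

Lemma F2mx_addrK m n (A B : 'M['F_2]_(m, n)) : A + B + B = A.
Proof. by rewrite -addrA F2mx_addrr addr0. Qed.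

(** * Gram factorizations of symmetric matrices over F_2 *)

Lemma outer_mxE (R : pzSemiRingType) n (a : 'cV[R]_n) i j : (a *m a^T) i j = a i 0 * a j 0.
Proof. by rewrite mxE big_ord1 mxE. Qed.

Lemma gram_row_mx (R : pzSemiRingType) n k (a : 'cV[R]_n) (M : 'M[R]_(n, k)) :
  row_mx a M *m (row_mx a M)^T = a *m a^T + M *m M^T.
Proof. by rewrite tr_row_mx mul_row_col. Qed.

Lemma diag_gram_F2 n k (M : 'M['F_2]_(n, k)) i :
  (M *m M^T) i i = \sum_j M i j.
Proof. by rewrite mxE; apply: eq_bigr => j _; rewrite mxE F2_mulrr. Qed.

(** By symmetry the added term is [A x x^T A], whose rows lie in the row space of [A]. *)
Lemma symm_outer_sub n (A : 'M['F_2]_n) (x : 'cV_n) : A^T = A ->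
  ((A + (A *m x) *m (A *m x)^T)%R <= A)%MS.
Proof.
by move=> symA; rewrite addmx_sub // trmx_mul symA mulmxA submxMl.
Qed.

(* Wedderburn's rank reduction: [x] joins the kernel of the new matrix. *)
Lemma rank_reduction n (A : 'M['F_2]_n) (x : 'cV_n) : A^T = A ->
  x^T *m A *m x = 1%:M -> (\rank (A + (A *m x) *m (A *m x)^T)%R < \rank A)%N.
Proof.
move=> symA xAx; set B := A + _.
have sBA : (B <= A)%MS by apply: symm_outer_sub.
have [leBA eqBA] := mxrank_leqif_sup sBA.
rewrite ltn_neqAle leBA eqBA andbT; apply/negP=> /submxP[W defA].
have Bx0 : B *m x = 0.
  by rewrite mulmxDl trmx_mul symA -[_ *m _ *m x]mulmxA xAx mulmx1 F2mx_addrr.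
have Ax0 : A *m x = 0 by rewrite defA -mulmxA Bx0 mulmx0.
move: xAx; rewrite -mulmxA Ax0 mulmx0 => /matrixP/(_ 0 0).
by rewrite !mxE eqxx => /esym/eqP; rewrite oner_eq0.
Qed.

(* With [d] the diagonal of [A], one has [x^T A x = d . x], and the diagonal of
   the reduced matrix is [d + A x]. The [x] found below is either a unit vector
   or [e_i + e_k] with [A i i = 1] and [A k k = 0]. *)
Lemma reduction_vector n (A : 'M['F_2]_n) i : A^T = A -> A i i != 0 ->
  exists x : 'cV_n, x^T *m A *m x = 1%:M /\
    let B := A + (A *m x) *m (A *m x)^T in
    B = 0 \/ exists j, B j j != 0.
Proof.
move=> symA Aii.
have symE k l : A k l = A l k by rewrite -{1}symA mxE.
pose e k : 'cV['F_2]_n := delta_mx k 0.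
have qe k l : (e k)^T *m A *m e l = (A k l)%:M.
  rewrite trmx_delta -rowE -colE; apply/matrixP=> a b.
  by rewrite !mxE !ord1 eqxx.
have Ae k j : (A *m e k) j 0 = A j k by rewrite -colE mxE.
have reduce (x : 'cV_n) j : x^T *m A *m x = 1%:M -> A j j + (A *m x) j 0 != 0 ->
    exists x : 'cV_n, x^T *m A *m x = 1%:M /\
    let B := A + (A *m x) *m (A *m x)^T in B = 0 \/ exists j, B j j != 0.
  move=> xAx nz; exists x; split=> //; right; exists j.
  by rewrite mxE outer_mxE F2_mulrr.
have qe1 k : A k k != 0 -> (e k)^T *m A *m e k = 1%:M.
  by move=> /F2_neq0 Akk; rewrite qe Akk.
case: (boolP [exists k, (A k k != 0) && [exists j, A j j + A j k != 0]]).
  case/existsP=> k /andP[Akk /existsP[j nz]].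
  by apply: (reduce (e k) j); [apply: qe1 | rewrite Ae].
move/existsPn=> eqd.
(* No unit vector works, so every column [k] with [A k k = 1] equals the diagonal of [A]. *)
have {eqd} diagE k j : A k k != 0 -> A j j = A j k.
  move=> Akk; have := eqd k; rewrite Akk => /existsPn/(_ j).
  by rewrite negbK => /eqP /F2_eq_add0.
set B := A + (A *m e i) *m (A *m e i)^T.
have [B0|nzB] := eqVneq B 0; first by exists (e i); split; [apply: qe1 | left].
have /existsP[j /existsP[k]] : [exists j, exists k, B j k != 0].
  apply: contraT => /existsPn B0; case/eqP: nzB; apply/matrixP=> j k.
  by have /existsPn/(_ k) := B0 j; rewrite negbK => /eqP->; rewrite mxE.
rewrite mxE outer_mxE !Ae -(diagE i k) // => Bjk.
have Akk : A k k = 0.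
  apply/eqP; apply: contraNT Bjk => Akk; rewrite (F2_neq0 Akk) mulr1.
  by rewrite -!diagE // F2_addrr.
(* Column [i] is the diagonal of [A], so the new entry at [j] is [A j j + A j i + A j k = A j k],
   nonzero by [Bjk]. *)
apply: (reduce (e i + e k) j); last first.
  by rewrite mulmxDr mxE !Ae -diagE // addrA F2_addrr add0r;
     rewrite Akk mulr0 addr0 in Bjk.
rewrite [(_ + _)^T]linearD /= !mulmxDl !mulmxDr !qe Akk (F2_neq0 Aii) (symE i k).
by rewrite raddf0 addr0 F2mx_addrK.
Qed.

(** Each induction step splits off one column [A x] and lowers the rank. As [r] need only bound the
    rank, a zero remainder is padded with zero columns. *)
Lemma nonalternating_gram n r (A : 'M['F_2]_n) i : A^T = A ->
  (\rank A <= r)%N -> A i i != 0 -> exists M : 'M_(n, r), A = M *m M^T.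
Proof.
elim: r A i => [|r IHr] A i symA rA Aii.
  by case/eqP: Aii; move: rA; rewrite leqn0 mxrank_eq0 => /eqP->; rewrite mxE.
have [x [xAx /= Bdiag]] := reduction_vector symA Aii.
set a := A *m x in Bdiag.
suff [M defM] : exists M : 'M_(n, r), A + a *m a^T = M *m M^T.
  exists (row_mx a M); rewrite gram_row_mx -defM addrC F2mx_addrK //.
case: Bdiag => [->|[j nz]]; first by exists 0; rewrite mul0mx.
apply: IHr nz; first by rewrite linearD /= symA trmx_mul trmxK.
by rewrite -ltnS; apply: leq_trans rA; apply: rank_reduction.
Qed.

(* If [A] has zero diagonal and [a] is a nonzero column of [A], then [A + a a^T]
   has nonzero diagonal and its rank is at most that of [A]. *)
Lemma symmetric_gramS n (A : 'M['F_2]_n) : A^T = A -> A != 0 ->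
  exists M : 'M_(n, (\rank A).+1), A = M *m M^T.
Proof.
move=> symA nzA.
case: (boolP [exists i, A i i != 0]) => [/existsP[i Aii]|/existsPn altA].
  by apply: nonalternating_gram Aii.
have /existsP[j /existsP[k Ajk]] : [exists j, exists k, A j k != 0].
  apply: contraT => /existsPn A0; case/eqP: nzA; apply/matrixP=> j k.
  by have /existsPn/(_ k) := A0 j; rewrite negbK => /eqP->; rewrite mxE.
pose x : 'cV['F_2]_n := delta_mx k 0; pose a := A *m x.
have [M defM] : exists M : 'M_(n, \rank A), A + a *m a^T = M *m M^T.
  apply: (@nonalternating_gram _ _ _ j).
  - by rewrite linearD /= symA trmx_mul trmxK.
  - by apply/mxrankS/symm_outer_sub.
  have := altA j; rewrite negbK mxE outer_mxE => /eqP->.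
  by rewrite F2_mulrr add0r /a -colE mxE.
by exists (row_mx a M); rewrite gram_row_mx -defM addrC F2mx_addrK.
Qed.

(** As [x * x = x], the diagonal of [M M^T] lists the row sums of [M], so [M] kills the all-ones
    vector, which is nonzero because [0 < k]. *)
Lemma alternating_gram_rank n k (M : 'M['F_2]_(n, k)) : (0 < k)%N ->
  (forall i, (M *m M^T) i i = 0) -> (\rank (M *m M^T) < k)%N.
Proof.
move=> k_gt0 alt; apply: leq_ltn_trans (mxrankM_maxl _ _) _.
rewrite ltn_neqAle rank_leq_col andbT; apply/negP=> /eqP fullM.
have M1 : M *m const_mx 1 = 0 :> 'cV_n.
  apply/matrixP=> i j; rewrite [RHS]mxE mxE -[RHS](alt i) diag_gram_F2.
  by apply: eq_bigr => l _; rewrite mxE mulr1.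
have /eqP : const_mx 1 = 0 :> 'cV['F_2]_k.
  have /row_fullP[W WM] : row_full M by rewrite /row_full fullM.
  by rewrite -[LHS]mul1mx -WM -mulmxA M1 mulmx0.
apply/negP; apply/eqP=> /matrixP/(_ (Ordinal k_gt0) 0); rewrite !mxE.
by apply/eqP; rewrite oner_eq0.
Qed.

(** * Set systems and their Gram matrices *)

Lemma sum_natr_card (R : pzSemiRingType) (T : finType) (P : pred T) :
  (#|[set x | P x]|)%:R = \sum_x (P x)%:R :> R.
Proof.
rewrite -sum1_card natr_sum big_mkcond; apply: eq_bigr => x _.
by rewrite inE; case: (P x).
Qed.

(* Repeated columns cancel in pairs, so it is enough to keep one copy of each
   column of odd multiplicity. *)
Lemma set_system_of_gram (G : sgraph) k (M : 'M['F_2]_(#|G|, k)) :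
  exists C : {set {set G}}, (#|C| <= k)%N /\
    forall u v, (#|[set S in C | (u \in S) && (v \in S)]|)%:R =
      (M *m M^T) (enum_rank u) (enum_rank v).
Proof.
pose col_set j := [set v : G | M (enum_rank v) j != 0].
pose C := [set S | odd #|[set j | col_set j == S]|]; exists C; split.
  have /subset_leq_card : C \subset [set col_set j | j : 'I_k].
    apply/subsetP=> S; rewrite inE.
    have [->|[j]] := set_0Vmem [set j | col_set j == S]; first by rewrite cards0.
    by rewrite inE => /eqP <- _; apply: imset_f.
  by move=> /leq_trans-> //; rewrite -[leqRHS]card_ord leq_imset_card.
move=> u v; rewrite sum_natr_card mxE.
rewrite (partition_big col_set predT) //=; apply: eq_bigr => S _.
rewrite inE -mulnb natrM -F2_natr_odd sum_natr_card mulr_suml.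
rewrite [RHS]big_mkcond; apply: eq_bigr => j _.
case: eqP => [<-|_]; last by rewrite mul0r.
by rewrite mul1r !inE -mulnb natrM -!F2_eq_natr mxE.
Qed.

Definition incidence_mx (G : sgraph) (C : {set {set G}}) :
  'M['F_2]_(#|G|, #|C|) :=
  \matrix_(i < #|G|, j < #|C|) (enum_val i \in enum_val j)%:R.

Lemma incidence_gramE (G : sgraph) (C : {set {set G}}) i j :
  (incidence_mx C *m (incidence_mx C)^T) i j =
  (#|[set S in C | (enum_val i \in S) && (enum_val j \in S)]|)%:R.
Proof.
rewrite sum_natr_card mxE.
rewrite (eq_bigr (fun S =>
    (S \in C)%:R * (enum_val i \in S)%:R * (enum_val j \in S)%:R)); last first.
  by move=> S _; rewrite -!natrM !mulnb andbA.
rewrite [RHS](bigID (mem C)) /= [X in _ + X]big1 ?addr0; last first.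
  by move=> S /negbTE->; rewrite !mul0r.
rewrite [RHS]big_enum_val; apply: eq_bigr => k _.
by rewrite !mxE enum_valP mul1r.
Qed.

(** * Fitting matrices over F_2 and complementation systems *)

(** Since 1 is the only nonzero scalar, the graph fixes all off-diagonal entries and only the
    diagonal is free. *)
Lemma fits_F2P (G : sgraph) (A : 'M['F_2]_#|G|) :
  reflect (A^T = A /\ forall i j, i != j ->
             A i j = (edge (enum_val i) (enum_val j))%:R) (fits A).
Proof.
apply: (iffP andP) => -[]; first move/eqP => symA offd; last first.
  move=> symA offd; rewrite symA eqxx; split=> //.
  apply/forallP=> i; apply/forallP=> j; apply/implyP=> /offd->.
  by case: (edge _ _); rewrite ?oner_eq0 ?eqxx.
split=> // i j ij; rewrite [LHS]F2_eq_natr.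
by move/forallP/(_ i)/forallP/(_ j): offd; rewrite ij => /eqP->.
Qed.

Lemma fits_F2_diag_inj (G : sgraph) (A B : 'M['F_2]_#|G|) :
  fits A -> fits B -> (forall i, A i i = B i i) -> A = B.
Proof.
move=> /fits_F2P[_ offA] /fits_F2P[_ offB] diagAB; apply/matrixP=> i j.
by have [<-//|ij] := eqVneq i j; rewrite offA ?offB.
Qed.

Lemma is_scsP (G : sgraph) (C : {set {set G}}) :
  reflect (forall u v, u != v ->
    edge u v = odd #|[set S in C | (u \in S) && (v \in S)]|) (is_scs C).
Proof.
apply: (iffP forallP) => scs u; last first.
  by apply/forallP=> v; apply/implyP=> uv; apply/eqP/scs.
by move=> v uv; move/forallP/(_ v): (scs u); rewrite uv => /eqP.
Qed.

Lemma fits_incidence_gram (G : sgraph) (C : {set {set G}}) :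
  is_scs C -> fits (incidence_mx C *m (incidence_mx C)^T).
Proof.
move=> /is_scsP scs; apply/fits_F2P; split=> [|i j ij].
  by rewrite trmx_mul trmxK.
by rewrite incidence_gramE F2_natr_odd -scs // (inj_eq enum_val_inj).
Qed.

Lemma scs_of_gram (G : sgraph) k (A : 'M['F_2]_#|G|) (M : 'M_(#|G|, k)) :
  fits A -> A = M *m M^T -> exists C : {set {set G}},
    [/\ is_scs C, (#|C| <= k)%N &
     forall i, odd #|[set S in C | enum_val i \in S]| = (A i i != 0)].
Proof.
move=> /fits_F2P[_ offd] defA; have [C [leCk]] := set_system_of_gram M.
rewrite -defA => CE.
exists C; split=> // [|i].
  apply/is_scsP => u v uv; rewrite F2_odd_neq0 CE offd ?(inj_eq enum_rank_inj) //.
  by rewrite !enum_rankK; case: (edge u v); rewrite ?oner_eq0 ?eqxx.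
rewrite -[i in RHS]enum_valK -CE -F2_odd_neq0; congr (odd _).
by apply: eq_card => S; rewrite !inE andbb.
Qed.

(** * Comparison of [c2] and [mr] *)

Lemma c2_leq (G : sgraph) (C : {set {set G}}) : is_scs C -> (c2 G <= #|C|)%N.
Proof.
move=> scs; rewrite /c2; case: ex_minnP => m _; apply.
by apply/existsP; exists C; rewrite scs eqxx.
Qed.

Lemma min_scs_exists (G : sgraph) : exists C : {set {set G}}, is_min_scs C.
Proof.
rewrite /is_min_scs /c2; case: ex_minnP => m /existsP[C /andP[scs /eqP Cm]] _.
by exists C.
Qed.

Lemma mr_leq (F : finFieldType) (G : sgraph) (A : 'M[F]_#|G|) :
  fits A -> (mr G F <= \rank A)%N.
Proof.
move=> fA; rewrite /mr; case: ex_minnP => m _; apply.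
by apply/existsP; exists A; rewrite fA eqxx.
Qed.

Lemma min_rank_fit_exists (F : finFieldType) (G : sgraph) :
  exists A : 'M[F]_#|G|, is_min_rank_fit A.
Proof.
rewrite /is_min_rank_fit /mr.
case: ex_minnP => m /existsP[A /andP[fA /eqP Am]] _.
by exists A.
Qed.

Lemma fits_neq0 (G : sgraph) (A : 'M['F_2]_#|G|) :
  has_edge G -> fits A -> A != 0.
Proof.
case=> u [v uv] /fits_F2P[_ offd]; apply/eqP => A0.
have nuv : u != v by apply: contraTneq uv => ->; rewrite edge_irr.
have := offd (enum_rank u) (enum_rank v).
rewrite (inj_eq enum_rank_inj) nuv A0 mxE !enum_rankK uv => /(_ isT)/esym/eqP.
by rewrite oner_eq0.
Qed.

Lemma mr_leq_c2 (G : sgraph) : (mr G 'F_2 <= c2 G)%N.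
Proof.
have [C [scs <-]] := min_scs_exists G.
apply: leq_trans (mr_leq (fits_incidence_gram scs)) _.
exact: leq_trans (mxrankM_maxl _ _) (rank_leq_col _).
Qed.

Lemma scs_of_fit (G : sgraph) (A : 'M['F_2]_#|G|) :
  has_edge G -> fits A -> exists C : {set {set G}},
    [/\ is_scs C, (#|C| <= \rank A + 1)%N &
     forall i, odd #|[set S in C | enum_val i \in S]| = (A i i != 0)].
Proof.
move=> hG fA; have [symA _] := fits_F2P _ fA.
have [M defM] := symmetric_gramS symA (fits_neq0 hG fA).
by rewrite addn1; apply: scs_of_gram defM.
Qed.

Lemma c2_leq_mrS (G : sgraph) : has_edge G -> (c2 G <= mr G 'F_2 + 1)%N.
Proof.
move=> hG; have [A [fA <-]] := min_rank_fit_exists 'F_2 G.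
have [C [scs leC _]] := scs_of_fit hG fA.
exact: leq_trans (c2_leq scs) leC.
Qed.

Lemma c2_leq_mr (G : sgraph) (A : 'M['F_2]_#|G|) i :
  is_min_rank_fit A -> A i i != 0 -> (c2 G <= mr G 'F_2)%N.
Proof.
move=> [fA <-] Aii; have [symA _] := fits_F2P _ fA.
have [M defM] := nonalternating_gram symA (leqnn _) Aii.
have [C [scs leC _]] := scs_of_gram fA defM.
exact: leq_trans (c2_leq scs) leC.
Qed.

(** Evenness makes the diagonal of the Gram matrix zero, so its rank is below the number of sets; an
    edge guarantees at least one set. *)
Lemma mr_ltn_even_scs (G : sgraph) (C : {set {set G}}) : has_edge G ->
  is_scs C -> (forall v : G, ~~ odd #|[set S in C | v \in S]|) ->
  (mr G 'F_2 < #|C|)%N.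
Proof.
move=> hG scs evenC; apply: leq_ltn_trans (mr_leq (fits_incidence_gram scs)) _.
apply: alternating_gram_rank => [|i].
  case: hG => u [v uv]; rewrite lt0n cards_eq0; apply: contraTneq uv => C0.
  have [->|nuv] := eqVneq u v; first by rewrite edge_irr.
  rewrite (is_scsP _ scs) // C0 (_ : [set S in _ | _] = set0) ?cards0 //.
  by apply/setP=> S; rewrite !inE.
apply/eqP; rewrite -[_ == 0]negbK incidence_gramE -F2_odd_neq0.
rewrite (_ : [set S in C | _] = [set S in C | enum_val i \in S]) //.
by apply/setP=> S; rewrite !inE andbb.
Qed.

(** The Gram matrix of a minimum system has rank at most [c2 G], hence minimum rank; were its
    diagonal zero, the system would be even and have more than [mr G 'F_2] sets. *)
Lemma min_rank_fit_nonalternating (G : sgraph) : has_edge G ->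
  c2 G = mr G 'F_2 ->
  exists A : 'M['F_2]_#|G|, is_min_rank_fit A /\ exists i, A i i != 0.
Proof.
move=> hG eq_c2; have [C [scs cardC]] := min_scs_exists G.
have fA := fits_incidence_gram scs; set A := _ *m _ in fA.
exists A; split.
  split=> //; apply/eqP; rewrite eqn_leq mr_leq // andbT -eq_c2 -cardC.
  exact: leq_trans (mxrankM_maxl _ _) (rank_leq_col _).
case: (boolP [exists i, A i i != 0]) => [/existsP//|/existsPn altA].
suff: (mr G 'F_2 < #|C|)%N by rewrite cardC eq_c2 ltnn.
apply: mr_ltn_even_scs => // v; rewrite F2_odd_neq0.
have := altA (enum_rank v); rewrite incidence_gramE enum_rankK.
rewrite (_ : [set S in C | (v \in S) && (v \in S)] = [set S in C | v \in S]) //.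
by apply/setP=> S; rewrite !inE andbb.
Qed.

(** * Exchange of blocks over unions of components *)

(** The row spaces of [D A = A D] and [(1 - D) A = A (1 - D)] lie in that of [A] and meet in 0: on
    their intersection, right multiplication by [D] is both the identity and zero. *)
Lemma mxrank_comm_idem (F : fieldType) n (D A : 'M[F]_n) :
  D *m D = D -> D *m A = A *m D ->
  (\rank (D *m A) + \rank ((1%:M - D) *m A) <= \rank A)%N.
Proof.
move=> idemD commDA; have commEA : (1%:M - D) *m A = A *m (1%:M - D).
  by rewrite mulmxBl mulmxBr mul1mx mulmx1 commDA.
rewrite -mxrank_disjoint_sum; first by rewrite mxrankS // addsmx_sub !submxMl.
set U := (_ :&: _)%MS.
have /submxP[V UV] : (U <= A *m D)%MS by rewrite -commDA capmxSl.
have /submxP[W UW] : (U <= A *m (1%:M - D))%MS by rewrite -commEA capmxSr.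
have <- : U *m D = U by rewrite UV -!mulmxA idemD.
by rewrite UW -!mulmxA mulmxBl mul1mx idemD subrr !mulmx0.
Qed.

Section ComponentBlock.
Variables (G : sgraph) (S : {set G}).
Hypothesis closedS : forall u v, edge u v -> (u \in S) = (v \in S).

Let vtx (i : 'I_#|induced S|) : 'I_#|G| := enum_rank (val (enum_val i)).
(** [P A P^T] is the principal submatrix of [A] on [S], and [P^T P] is the coordinate projection
    onto [S]. *)
Let P : 'M['F_2]_(#|induced S|, #|G|) := rowsub vtx 1%:M.

Let vtx_inj : injective vtx.
Proof. by move=> i j /enum_rank_inj/val_inj/enum_val_inj. Qed.

Let PE i j : P i j = (vtx i == j)%:R.
Proof. by rewrite !mxE. Qed.

Let mulP k (A : 'M_(#|G|, k)) : P *m A = rowsub vtx A.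
Proof. by rewrite mul_rowsub_mx mul1mx. Qed.

Let restrictE (A : 'M_#|G|) i j : (P *m A *m P^T) i j = A (vtx i) (vtx j).
Proof.
by rewrite -[P *m A *m P^T]trmxK trmx_mul trmxK !mulP !mxE.
Qed.

Let PPt : P *m P^T = 1%:M.
Proof.
by apply/matrixP=> i j; rewrite mulP !mxE eq_sym (inj_eq vtx_inj).
Qed.

Let PtPE : P^T *m P = diag_mx (\row_j (enum_val j \in S)%:R).
Proof.
apply/matrixP=> j k; rewrite !mxE.
case: (boolP (enum_val j \in S)) => jS; last first.
  rewrite mul0rn big1 // => i _; rewrite mxE PE.
  case: eqP => [ij|_]; last by rewrite mul0r.
  by case/negP: jS; rewrite -ij enum_rankK; apply: valP.
pose x : induced S := exist _ (enum_val j) jS.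
have vx : vtx (enum_rank x) = j by rewrite /vtx enum_rankK enum_valK.
rewrite (bigD1 (enum_rank x)) //= big1 ?addr0 => [|i ix]; rewrite [P^T _ _]mxE !PE.
  by rewrite vx eqxx mul1r.
by rewrite -vx (inj_eq vtx_inj) (negbTE ix) mul0r.
Qed.

Lemma fits_component_block (A : 'M['F_2]_#|G|) : fits A ->
  @fits _ (induced S) (P *m A *m P^T).
Proof.
move=> /fits_F2P[symA offd]; apply/fits_F2P; split=> [|i j ij].
  by rewrite !trmx_mul trmxK symA mulmxA.
by rewrite restrictE offd ?(inj_eq vtx_inj) // !enum_rankK.
Qed.

(** Adding [P^T (B - R) P] swaps the block [R = P A P^T] for [B]. The rank bound is stated with sums
    to avoid truncated subtraction. *)
Lemma replace_component_block (A : 'M['F_2]_#|G|) (B : 'M_#|induced S|) :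
  fits A -> @fits _ (induced S) B -> exists A' : 'M_#|G|,
    [/\ fits A', P *m A' *m P^T = B &
     (\rank A' + \rank (P *m A *m P^T)%R <= \rank B + \rank A)%N].
Proof.
move=> fA fB; have fR := fits_component_block fA.
set R := P *m A *m P^T in fR *.
have [symA offA] := fits_F2P _ fA; have [symB offB] := fits_F2P _ fB.
have [symR offR] := fits_F2P _ fR.
exists (A + P^T *m (B - R) *m P); split.
- apply/fits_F2P; split=> [|j k jk].
    by rewrite linearD /= symA !trmx_mul trmxK linearB /= symB symR mulmxA.
  (* [B] and [R] fit the same graph, so [B - R] is diagonal and off-diagonal entries are
     unchanged. *)
  rewrite mxE offA // [X in _ + X]mxE big1 ?addr0 // => l _.
  rewrite mxE big_distrl big1 //= => i _; rewrite [P^T _ _]mxE !PE.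
  case: eqP => [ij|_]; last by rewrite !mul0r.
  case: eqP => [lk|_]; last by rewrite mulr0.
  have il : i != l by apply: contraNneq jk => il; rewrite -ij -lk il.
  by rewrite [(B - R) i l]mxE [(- R) i l]mxE offB // offR // subrr mulr0 mul0r.
- rewrite mulmxDr mulmxDl -/R !mulmxA PPt mul1mx -[_ *m P *m P^T]mulmxA PPt.
  by rewrite mulmx1 addrC subrK.
pose D := P^T *m P.
have idemD : D *m D = D by rewrite /D mulmxA -[_ *m P *m P^T]mulmxA PPt mulmx1.
(* No edge leaves [S], so the entries of [A] between [S] and its complement vanish. *)
have commDA : D *m A = A *m D.
  rewrite /D PtPE; apply/matrixP=> j k; rewrite mul_diag_mx mul_mx_diag !mxE.
  have [->|jk] := eqVneq j k; first by rewrite mulrC.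
  rewrite offA //; case: (boolP (edge _ _)) => [/closedS->|_].
    by rewrite mulrC.
  by rewrite mul0r mulr0.
have -> : A + P^T *m (B - R) *m P = P^T *m B *m P + (1%:M - D) *m A.
  rewrite mulmxBr mulmxBl mulmxBl mul1mx addrCA; congr (_ + (_ - _)).
  by rewrite /R !mulmxA -/D -mulmxA -/D -mulmxA -commDA mulmxA idemD.
have rankR : (\rank R <= \rank (D *m A))%N.
  have -> : R = P *m (D *m A) *m P^T by rewrite /R /D !mulmxA PPt mul1mx.
  exact: leq_trans (mxrankM_maxl _ _) (mxrankM_maxr _ _).
have rankB : (\rank (P^T *m B *m P) <= \rank B)%N.
  exact: leq_trans (mxrankM_maxl _ _) (mxrankM_maxr _ _).
apply: leq_trans (leq_add (mxrank_add _ _) rankR) _.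
by rewrite -addnA leq_add // addnC mxrank_comm_idem.
Qed.

(** A block of smaller rank could be substituted, giving a fit of [G] of rank below [mr G 'F_2]. *)
Lemma min_rank_fit_component_block (A : 'M['F_2]_#|G|) : is_min_rank_fit A ->
  @is_min_rank_fit _ (induced S) (P *m A *m P^T).
Proof.
move=> [fA rankA]; have fR := fits_component_block fA; split=> //.
have [B [fB rankB]] := min_rank_fit_exists 'F_2 (induced S).
have [A' [fA' _]] := replace_component_block fA fB.
move=> rankA'; apply/eqP; rewrite eqn_leq mr_leq // andbT -rankB.
rewrite -(leq_add2r (\rank A)); apply: leq_trans rankA'.
by rewrite addnC leq_add2r rankA mr_leq.
Qed.

Lemma component_c2_eq_mr : has_edge (induced S) ->
  c2 (induced S) = mr (induced S) 'F_2 -> (c2 G <= mr G 'F_2)%N.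
Proof.
move=> hS /(min_rank_fit_nonalternating hS)[B [[fB rankB] [i Bii]]].
have [A [fA rankA]] := min_rank_fit_exists 'F_2 G.
have [A' [fA' blockA' rankA']] := replace_component_block fA fB.
have minA' : is_min_rank_fit A'.
  split=> //; apply/eqP; rewrite eqn_leq mr_leq // andbT -rankA.
  rewrite -(leq_add2r (\rank B)) [leqRHS]addnC; apply: leq_trans rankA'.
  by rewrite leq_add2l rankB mr_leq ?fits_component_block.
by apply: (@c2_leq_mr _ _ (vtx i) minA'); rewrite -restrictE blockA'.
Qed.

Lemma component_c2_leq_mr (A : 'M['F_2]_#|G|) v : v \in S ->
  is_min_rank_fit A -> A (enum_rank v) (enum_rank v) != 0 ->
  has_edge (induced S) /\ (c2 (induced S) <= mr (induced S) 'F_2)%N.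
Proof.
move=> vS minA Avv; have minR := min_rank_fit_component_block minA.
pose i : 'I_#|induced S| := enum_rank (exist _ v vS : induced S).
have Rii : (P *m A *m P^T) i i != 0 by rewrite restrictE /vtx enum_rankK.
split; last exact: c2_leq_mr minR Rii.
case: (boolP [exists x : induced S, exists y : induced S, edge x y]).
  by case/existsP=> x /existsP[y xy]; exists x, y.
(* Without edges the zero matrix fits, so the minimum rank block would be 0, against [Rii]. *)
move=> /existsPn noedge; case/eqP: Rii.
suff fits0 : @fits 'F_2 (induced S) 0.
  have := mr_leq fits0; rewrite -minR.2 mxrank0 leqn0 mxrank_eq0 => /eqP->.
  by rewrite mxE.
apply/fits_F2P; split=> [|j k _]; first by rewrite trmx0.
have /existsPn/(_ (enum_val k)) := noedge (enum_val j).
by move=> /negbTE->; rewrite mxE.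
Qed.

End ComponentBlock.

(** * Components and the equivalence *)

Lemma component_closed (G : sgraph) (S : {set G}) : S \in components G ->
  forall u v, edge u v -> (u \in S) = (v \in S).
Proof.
case/imsetP=> x _ -> u v uv; rewrite !inE /=.
exact: (same_connect1r (sym_connect_sym (@edge_sym G)) uv).
Qed.

Lemma component_cover (G : sgraph) (v : G) :
  exists2 S, S \in components G & v \in S.
Proof.
exists [set y in [set: G] | connect (@edge G) v y]; last by rewrite !inE connect0.
by apply/imsetP; exists v.
Qed.

(** An isolated vertex has [c2] and [mr] equal to 0, so the last condition concerns the components
    that have an edge. *)
Theorem theorem4p12 (G : sgraph) (hG : has_edge G) :
  [<-> c2 G <> mr G 'F_2;
       c2 G = (mr G 'F_2 + 1)%N;
       exists A : 'M['F_2]_#|G|,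
         [/\ is_min_rank_fit A,
             forall B : 'M['F_2]_#|G|, is_min_rank_fit B -> B = A
           & forall i, A i i = 0];
       exists C : {set {set G}},
         is_min_scs C /\ forall v : G, ~~ odd #|[set S in C | v \in S]|;
       forall S : {set G}, S \in components G -> has_edge (induced S) ->
         c2 (induced S) = (mr (induced S) 'F_2 + 1)%N].
Proof.
have mr_lt_c2 : c2 G <> mr G 'F_2 -> c2 G = (mr G 'F_2 + 1)%N.
  move=> /eqP neq; apply/eqP; rewrite eqn_leq c2_leq_mrS // addn1.
  by rewrite ltn_neqAle eq_sym neq mr_leq_c2.
tfae=> [//|eq_c2|[A [minA uniqA altA]]|[C [[scsC minC] evenC]]|eq_comp eq_c2].
(* A nonzero diagonal entry in a minimum rank fit would give [c2 G <= mr G 'F_2]; with zero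
   diagonals, all such fits agree. *)
- have alt (A : 'M['F_2]_#|G|) : is_min_rank_fit A -> forall i, A i i = 0.
    move=> minA i; apply/eqP; apply: contraT => /(c2_leq_mr minA).
    by rewrite eq_c2 addn1 ltnn.
  have [A minA] := min_rank_fit_exists 'F_2 G.
  exists A; split=> // [B minB|]; last exact: alt.
  by apply: fits_F2_diag_inj minB.1 minA.1 _ => i; rewrite !alt.
(* If [c2 G = mr G 'F_2], some minimum rank fit has a nonzero diagonal entry, but uniqueness makes
   it [A]. *)
- have eq_c2 : c2 G = (mr G 'F_2 + 1)%N.
    apply: mr_lt_c2 => /(min_rank_fit_nonalternating hG)[B [/uniqA-> [i]]].
    by rewrite altA eqxx.
  have [C [scsC leC oddC]] := scs_of_fit hG minA.1.
  exists C; split; last first.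
    by move=> v; rewrite -(enum_rankK v) oddC altA eqxx.
  split=> //; apply/eqP; rewrite eqn_leq c2_leq // andbT.
  by rewrite eq_c2 -minA.2.
(* Equality on one component would force [c2 G <= mr G 'F_2], yet an even system has more than
   [mr G 'F_2] sets. *)
- move=> S compS hS; apply/eqP; rewrite eqn_leq c2_leq_mrS // addn1.
  rewrite ltn_neqAle mr_leq_c2 andbT eq_sym; apply/eqP.
  move=> /(component_c2_eq_mr (component_closed compS) hS).
  by rewrite -minC leqNgt mr_ltn_even_scs.
(* The component of a vertex with nonzero diagonal entry violates the last condition. *)
have [A [minA [i Aii]]] := min_rank_fit_nonalternating hG eq_c2.
have [S compS vS] := component_cover (enum_val i).
rewrite -(enum_valK i) in Aii.
have [hS] := component_c2_leq_mr (component_closed compS) vS minA Aii.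
by rewrite eq_comp // addn1 ltnn.
Qed.
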